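(* Let $0<k<n$. The quotient algebra of $\mathcal{A}_{RE}(\mathcal{M}(n))$ by the relations $L^i_j=0$ for all $i,j\in\{1,\dots,n\}$ with $i>k$ or $j>k$ is isomorphic to $\mathcal{A}_{RE}(\mathcal{M}(k))$.
   Context: Scalars: $\mathbb{C}(q)$; $\omega=q-q^{-1}$. For $m\ge1$, $\mathcal{M}(m)$ is the algebra of $m\times m$ matrices with units $e^i_j$, $e^i_je^k_l=\delta^k_je^i_l$, and $$S=q\sum_{i=1}^m e^i_i\otimes e^i_i+\sum_{i\ne j}e^i_j\otimes e^j_i+\omega\sum_{i<k}e^i_i\otimes e^k_k\in\mathcal{M}(m)^{\otimes2}.$$ The reflection equation algebra $\mathcal{A}_{RE}(\mathcal{M}(m))$ is the unital associative algebra generated by the entries $L^i_j$ ($1\le i,j\le m$) of $L=\sum L^i_je^j_i$ subject to $L_2SL_2S=SL_2SL_2$, where $L_2=1\otimes L$. *)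

(* Defs.v *)
From HB Require Import structures.
From mathcomp Require Import all_boot all_order all_algebra.
From mathcomp Require Import boolp classical_sets reals.
From mathcomp Require Import complex mxtens.
From mathcomp Require Import monalg.

Set Implicit Arguments.
Unset Strict Implicit.
Unset Printing Implicit Defensive.
Import GRing.Theory.
Local Open Scope ring_scope.
Local Open Scope quotient_scope.

Definition alg_isomorphic (K : pzRingType) (A B : algType K) : Prop :=
  exists f : {lrmorphism A -> B}, bijective f.

Section QuotientAlgebra.
Variables (K : pzRingType) (A : algType K) (G : set A).

(* The two-sided ideal generated by G; it is automatically stable under
   scalars, since a *: x = (a *: 1) * x. *)
Inductive gen_ideal_spec : A -> Prop :=
  | gen_ideal_in x of G x : gen_ideal_spec x
  | gen_ideal_0 : gen_ideal_spec 0
  | gen_ideal_B x y of gen_ideal_spec x & gen_ideal_spec y :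
      gen_ideal_spec (x - y)
  | gen_ideal_Ml a x of gen_ideal_spec x : gen_ideal_spec (a * x)
  | gen_ideal_Mr a x of gen_ideal_spec x : gen_ideal_spec (x * a).

Definition gen_ideal : {pred A} := fun x => `[< gen_ideal_spec x >].

Lemma gen_idealP x : reflect (gen_ideal_spec x) (x \in gen_ideal).
Proof. exact: asboolP. Qed.

Lemma gen_ideal_zmod_closed : zmod_closed gen_ideal.
Proof.
split; first by apply/gen_idealP; exact: gen_ideal_0.
by move=> x y /gen_idealP Ix /gen_idealP Iy; apply/gen_idealP; exact: gen_ideal_B.
Qed.

HB.instance Definition _ :=
  GRing.isZmodClosed.Build A gen_ideal gen_ideal_zmod_closed.

Lemma gen_idealMl a x : x \in gen_ideal -> a * x \in gen_ideal.
Proof. by move=> /gen_idealP Ix; apply/gen_idealP; exact: gen_ideal_Ml. Qed.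

Lemma gen_idealMr a x : x \in gen_ideal -> x * a \in gen_ideal.
Proof. by move=> /gen_idealP Ix; apply/gen_idealP; exact: gen_ideal_Mr. Qed.

Lemma gen_idealZ (a : K) x : x \in gen_ideal -> a *: x \in gen_ideal.
Proof. by rewrite -{2}[x]mul1r scalerAl; exact: gen_idealMl. Qed.

(* GRing.Algebra requires 1 != 0, hence the properness argument. *)
Definition proper_relations : Prop := ~ gen_ideal_spec 1.

Definition quot_alg of proper_relations : Type :=
  @Quotient.quot A (gen_ideal : zmodClosed A).

Hypothesis pG : proper_relations.
Local Notation Q := (quot_alg pG).

HB.instance Definition _ := EqQuotient.on Q.
HB.instance Definition _ := GRing.Zmodule.on Q.

Definition quot_pi (x : A) : Q := \pi_(Q) x.

Lemma quot_piE x y : quot_pi x = quot_pi y <-> x - y \in gen_ideal.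
Proof. by rewrite Quotient.idealrBE; split=> [/eqP|/eqP]. Qed.

Lemma quot_pi_repr (u : Q) : quot_pi (repr u) = u.
Proof. exact: reprK. Qed.

Lemma quot_piD x y : quot_pi (x + y) = quot_pi x + quot_pi y.
Proof. exact: (raddfD (\pi_(Q))). Qed.

Lemma quot_repr_pi x : repr (quot_pi x) - x \in gen_ideal.
Proof. by apply/quot_piE; rewrite quot_pi_repr. Qed.

Definition quot_one : Q := quot_pi 1.
Definition quot_mul (u v : Q) : Q := quot_pi (repr u * repr v).
Definition quot_scale (a : K) (u : Q) : Q :=
  quot_pi (a *: repr u).

Lemma quot_mulE x y : quot_mul (quot_pi x) (quot_pi y) = quot_pi (x * y).
Proof.
apply/quot_piE.
rewrite -(subrKA (x * repr (quot_pi y))) -mulrBl -mulrBr.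
by apply: rpredD; [apply: gen_idealMr|apply: gen_idealMl]; exact: quot_repr_pi.
Qed.

Lemma quot_scaleE a x : quot_scale a (quot_pi x) = quot_pi (a *: x).
Proof.
by apply/quot_piE; rewrite -scalerBr; apply/gen_idealZ/quot_repr_pi.
Qed.

Lemma quot_ind (P : Q -> Prop) : (forall x, P (quot_pi x)) -> forall u, P u.
Proof. by move=> H u; rewrite -[u]quot_pi_repr. Qed.

Lemma quot_mulA : associative quot_mul.
Proof.
by elim/quot_ind=> x; elim/quot_ind=> y; elim/quot_ind=> z; rewrite !quot_mulE mulrA.
Qed.

Lemma quot_mul1 : left_id quot_one quot_mul.
Proof. by elim/quot_ind=> x; rewrite quot_mulE mul1r. Qed.

Lemma quot_mulr1 : right_id quot_one quot_mul.
Proof. by elim/quot_ind=> x; rewrite quot_mulE mulr1. Qed.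

Lemma quot_mulDl : left_distributive quot_mul +%R.
Proof.
elim/quot_ind=> x; elim/quot_ind=> y; elim/quot_ind=> z.
by rewrite -quot_piD !quot_mulE mulrDl quot_piD.
Qed.

Lemma quot_mulDr : right_distributive quot_mul +%R.
Proof.
elim/quot_ind=> x; elim/quot_ind=> y; elim/quot_ind=> z.
by rewrite -quot_piD !quot_mulE mulrDr quot_piD.
Qed.

Lemma quot_one_neq0 : quot_one != 0.
Proof.
have pi0 : quot_pi 0 = 0 by exact: (raddf0 (\pi_(Q))).
rewrite -pi0; apply/eqP => /(quot_piE 1 0).1; rewrite subr0.
by move/gen_idealP; exact: pG.
Qed.

HB.instance Definition _ := GRing.Zmodule_isNzRing.Build Q
  quot_mulA quot_mul1 quot_mulr1 quot_mulDl quot_mulDr quot_one_neq0.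

Lemma quot_scaleA a b u : quot_scale a (quot_scale b u) = quot_scale (a * b) u.
Proof. by elim/quot_ind: u => x; rewrite !quot_scaleE scalerA. Qed.

Lemma quot_scale1 : left_id 1 quot_scale.
Proof. by elim/quot_ind=> x; rewrite quot_scaleE scale1r. Qed.

Lemma quot_scaleDr : right_distributive quot_scale +%R.
Proof.
move=> a; elim/quot_ind=> x; elim/quot_ind=> y.
by rewrite -quot_piD !quot_scaleE scalerDr quot_piD.
Qed.

Lemma quot_scaleDl u : {morph quot_scale^~ u : a b / a + b}.
Proof. by move=> a b; elim/quot_ind: u => x; rewrite !quot_scaleE scalerDl quot_piD. Qed.

HB.instance Definition _ := GRing.Zmodule_isLmodule.Build K Q
  quot_scaleA quot_scale1 quot_scaleDr quot_scaleDl.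

Lemma quot_piM x y : quot_pi (x * y) = quot_pi x * quot_pi y.
Proof. exact/esym/quot_mulE. Qed.

Lemma quot_piZ (a : K) x : quot_pi (a *: x) = a *: quot_pi x.
Proof. exact/esym/quot_scaleE. Qed.

Lemma quot_scaleAl (a : K) (u v : Q) : a *: (u * v) = (a *: u) * v.
Proof.
elim/quot_ind: u => x; elim/quot_ind: v => y.
by rewrite -quot_piM -!quot_piZ -quot_piM scalerAl.
Qed.

Lemma quot_scaleAr (a : K) (u v : Q) : a *: (u * v) = u * (a *: v).
Proof.
elim/quot_ind: u => x; elim/quot_ind: v => y.
by rewrite -quot_piM -!quot_piZ -quot_piM scalerAr.
Qed.

HB.instance Definition _ :=
  GRing.Lmodule_isLalgebra.Build K Q quot_scaleAl.
HB.instance Definition _ :=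
  GRing.Lalgebra_isAlgebra.Build K Q quot_scaleAr.

Lemma quot_pi_is_linear : linear quot_pi.
Proof. by move=> a x y; rewrite quot_piD quot_piZ. Qed.

Lemma quot_pi_is_monoid_morphism : monoid_morphism quot_pi.
Proof. by split=> // x y; rewrite quot_piM. Qed.

HB.instance Definition _ := GRing.isLinear.Build K A Q _ quot_pi
  quot_pi_is_linear.
HB.instance Definition _ := GRing.isMonoidMorphism.Build A Q quot_pi
  quot_pi_is_monoid_morphism.

End QuotientAlgebra.

Arguments quot_alg {K A} G pG.
Arguments quot_pi {K A G} pG x.

Section QuotientLift.
Variables (K : pzRingType) (A : algType K) (G : set A).
Variables (B : nzRingType) (f : {rmorphism A -> B}).
Hypothesis fG : forall x, G x -> f x = 0.

Lemma gen_ideal_kernel x : gen_ideal_spec G x -> f x = 0.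
Proof.
elim=> {x} [x /fG//||x y _ fx _ fy|a x _ fx|a x _ fx]; first exact: rmorph0.
- by rewrite rmorphB fx fy subrr.
- by rewrite rmorphM fx mulr0.
- by rewrite rmorphM fx mul0r.
Qed.

Lemma kernel_proper_relations : proper_relations G.
Proof. by move=> /gen_ideal_kernel/eqP; rewrite rmorph1 oner_eq0. Qed.

Variable pG : proper_relations G.

(* The argument of type forall x, G x -> f x = 0 is what makes the ring
   morphism instance below inferable. *)
Definition quot_lift_of of (forall x, G x -> f x = 0) :=
  fun u : quot_alg G pG => f (repr u).
Local Notation quot_lift := (quot_lift_of fG).

Lemma quot_lift_pi x : quot_lift (quot_pi pG x) = f x.
Proof.
apply/eqP; rewrite -subr_eq0 -rmorphB; apply/eqP/gen_ideal_kernel.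
by apply/gen_idealP; exact: quot_repr_pi.
Qed.

Lemma quot_lift_is_zmod_morphism : zmod_morphism quot_lift.
Proof.
elim/quot_ind=> x; elim/quot_ind=> y.
by rewrite -(rmorphB (quot_pi pG)) !quot_lift_pi rmorphB.
Qed.

Lemma quot_lift_is_monoid_morphism : monoid_morphism quot_lift.
Proof.
split; first by rewrite -(rmorph1 (quot_pi pG)) quot_lift_pi rmorph1.
elim/quot_ind=> x; elim/quot_ind=> y.
by rewrite -(rmorphM (quot_pi pG)) !quot_lift_pi rmorphM.
Qed.

HB.instance Definition _ := GRing.isZmodMorphism.Build (quot_alg G pG) B quot_lift
  quot_lift_is_zmod_morphism.
HB.instance Definition _ := GRing.isMonoidMorphism.Build (quot_alg G pG) B
  quot_lift quot_lift_is_monoid_morphism.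

End QuotientLift.

(* The free associative unital algebra on I: the monoid algebra of the free
   (noncommutative) monoid on I. *)
Definition free_alg (K : fieldType) (I : choiceType) : Type :=
  malg (fmonom I) K.
HB.instance Definition _ (K : fieldType) (I : choiceType) :=
  GRing.Lalgebra.on (free_alg K I).

Definition free_gen (K : fieldType) (I : choiceType) (i : I) : free_alg K I :=
  << fmu i >>.

Section FreeAlgebraTheory.
Variables (K : fieldType) (I : choiceType).

Lemma free_scaleAr (a : K) (x y : free_alg K I) : a *: (x * y) = x * (a *: y).
Proof.
have malgC_comm (z : free_alg K I) :
    z * mkmalgU (one (s := fmonom I)) a = a *: z.
  rewrite -mul_malgC [LHS]fgmulgU [RHS]fgmulUg.
  apply: eq_bigr => m _.
  by rewrite mulrC mulm1 mul1m.
by rewrite -malgC_comm -mulrA malgC_comm.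
Qed.

HB.instance Definition _ :=
  GRing.Lalgebra_isAlgebra.Build K (free_alg K I) free_scaleAr.

Definition free_aug : free_alg K I -> K :=
  mcoeff (one (s := fmonom I)).
HB.instance Definition _ := GRing.RMorphism.on free_aug.

Lemma free_aug_gen i : free_aug (free_gen K i) = 0.
Proof.
rewrite /free_aug /free_gen mcoeffU; case: eqP => // e.
have := congr1 (fun w : fmonom I => size w) e.
by rewrite fmU fm1.
Qed.

End FreeAlgebraTheory.

Section ReflectionEquation.
Variables (K : fieldType) (q : K) (m : nat).

Local Notation e i j := (delta_mx i j : 'M_m).
Local Notation "A ⊗ B" := (tensmx A B) (at level 40).

(* M(m) (x) M(m) is identified with the (m * m)-matrices via the Kronecker
   product; e^i_j is the unit with entry 1 in row i and column j. *)
Definition RE_S : 'M[K]_(m * m) :=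
  q *: (\sum_(i < m) e i i ⊗ e i i)
  + \sum_(i < m) \sum_(j < m | i != j) e i j ⊗ e j i
  + (q - q^-1) *: \sum_(i < m) \sum_(k < m | (i < k)%N) e i i ⊗ e k k.

(* Both sides of L_2 S L_2 S = S L_2 S L_2 live in M(m) (x) M(m) (x) A. *)
Definition RE_relation (A : algType K) (L : 'M[A]_m) : 'M[A]_(m * m) :=
  let S := map_mx (in_alg A) RE_S in
  let L2 := (1%:M : 'M[A]_m) ⊗ L in
  L2 *m S *m L2 *m S - S *m L2 *m S *m L2.

Lemma RE_relation_map0 (A : algType K) (B : nzRingType) (f : {rmorphism A -> B})
    (L : 'M[A]_m) : map_mx f L = 0 -> map_mx f (RE_relation L) = 0.
Proof.
move=> L0; have L20 : map_mx f ((1%:M : 'M[A]_m) ⊗ L) = 0.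
  apply/matrixP => i j; rewrite !mxE rmorphM /=.
  move/matrixP: L0 => /(_ (mxtens_unindex i).2 (mxtens_unindex j).2).
  by rewrite mxE => ->; rewrite mxE mulr0.
by rewrite /RE_relation map_mxB !map_mxM L20 !(mul0mx, mulmx0) subrr.
Qed.

Local Notation F := (free_alg K ('I_m * 'I_m)%type).

(* The letter (i, j) stands for L^i_j, an upper and a lower index, so L^i_j
   sits in row j and column i of L. *)
Definition RE_freeL : 'M[F]_m :=
  \sum_(i < m) \sum_(j < m) (free_gen K (i, j) : F) *: delta_mx j i.

Definition RE_relations : set F :=
  [set x | exists a b, x = RE_relation RE_freeL a b].

Lemma RE_aug_relations x : RE_relations x -> free_aug x = 0.
Proof.
move=> [a [b ->]].
have L0 : map_mx (@free_aug K _) RE_freeL = 0.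
  apply/matrixP => i j; rewrite !mxE summxE rmorph_sum big1 // => i' _.
  rewrite summxE rmorph_sum big1 // => j' _.
  by rewrite mxE rmorphM /= free_aug_gen mul0r.
have /matrixP/(_ a b) := RE_relation_map0 L0.
by rewrite mxE [RHS]mxE.
Qed.

Lemma RE_relations_proper : proper_relations RE_relations.
Proof. exact: kernel_proper_relations RE_aug_relations. Qed.

Definition RE_alg : algType K := quot_alg RE_relations RE_relations_proper.

Definition RE_gen (i j : 'I_m) : RE_alg :=
  quot_pi RE_relations_proper (free_gen K (i, j)).

Definition RE_aug : {rmorphism RE_alg -> K} :=
  @quot_lift_of _ _ _ _ _ RE_relations_proper RE_aug_relations.

(* Indices range over {0, ..., m - 1}, so that i > k reads k <= i. *)
Definition RE_outer_gens (k : nat) : set RE_alg :=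
  [set x | exists i j : 'I_m, ((k <= i)%N \/ (k <= j)%N) /\ x = RE_gen i j].

Lemma RE_outer_gens_proper k : proper_relations (RE_outer_gens k).
Proof.
apply: (@kernel_proper_relations _ _ _ _ RE_aug) => x [i [j [_ ->]]].
exact: etrans (quot_lift_pi _ _ _) (free_aug_gen _ _).
Qed.

End ReflectionEquation.

Arguments RE_relations {K} q m _.
Arguments RE_relations_proper {K} q m _.
Arguments RE_alg {K} q m.
Arguments RE_gen {K} q {m} i j.
Arguments RE_outer_gens {K} q m k _.
Arguments RE_outer_gens_proper {K} q m k _.

Definition Cq (R : realType) : fieldType := {fraction {poly R[i]}}.
Definition qvar (R : realType) : Cq R := tofrac 'X.

(* Main.v *)
From HB Require Import structures.
Require Import Defs.
From mathcomp Require Import all_boot all_order all_algebra reals.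
From mathcomp Require Import mxtens monalg zify.

(* If L vanishes outside its upper left k x k block, so does L_2 S L_2 outside
   the span of the e_a (x) e_b with a, b <= k: an entry of S at (a, x), (c, y)
   with x, y <= k is zero as soon as a > k or c > k, the omega-terms
   e^i_i (x) e^j_j occurring only for i < j.  Since S preserves this span and its
   complement and restricts there to the S of size k, the reflection equation
   for L is equivalent to the one for its k x k block.  Hence padding with zeros
   and sending L^i_j to L^i_j extend to mutually inverse algebra morphisms. *)

Set Implicit Arguments.
Unset Strict Implicit.
Unset Printing Implicit Defensive.
Import GRing.Theory.
Local Open Scope ring_scope.

(** * Universal properties of quotients and of free algebras *)

Section Presentations.
Variable K : fieldType.

Lemma quot_pi_gen (A : algType K) (G : classical_sets.set A)
    (pG : proper_relations G) (x : A) : G x -> quot_pi pG x = 0.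
Proof.
move=> Gx; rewrite -(raddf0 (quot_pi pG)); apply/quot_piE; rewrite subr0.
exact/gen_idealP/gen_ideal_in.
Qed.

(** [quot_lift_of] only yields a ring morphism; scalability descends from [f] because [quot_pi] is
    linear and onto. *)
Lemma quot_alg_lift (A B : algType K) (G : classical_sets.set A)
    (pG : proper_relations G) (f : {lrmorphism A -> B}) :
  (forall x, G x -> f x = 0) ->
  exists g : {lrmorphism quot_alg G pG -> B}, forall x, g (quot_pi pG x) = f x.
Proof.
move=> fG; pose g := @quot_lift_of _ _ _ _ f pG fG.
have gE x : g (quot_pi pG x) = f x by exact: quot_lift_pi.
have gZ : scalable g.
  by move=> a; elim/quot_ind=> x; rewrite -linearZ !gE linearZ.
pose gZM := GRing.isScalable.Build K (quot_alg G pG) B *:%R g gZ.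
pose gL : {lrmorphism quot_alg G pG -> B} := HB.pack g gZM.
by exists gL.
Qed.

Lemma free_alg_monomE (I : choiceType) (w : fmonom I) :
  << w >> = \prod_(i <- (w : seq I)) free_gen K i :> free_alg K I.
Proof.
case: w => s; elim: s => [|i s IHs].
  by rewrite big_nil; congr << _ >>; apply: val_inj; rewrite /= fm1.
rewrite big_cons /= -IHs /free_gen.
rewrite [RHS]malgM_def fgmulUU mulr1; congr << _ >>; apply: val_inj.
by rewrite /= fmM fmU.
Qed.

Lemma free_alg_ext (I : choiceType) (A : algType K)
    (f g : {lrmorphism free_alg K I -> A}) :
  (forall i, f (free_gen K i) = g (free_gen K i)) -> f =1 g.
Proof.
move=> fg x.
have fgU c w : f (<< c *g w >> : free_alg K I) = g (<< c *g w >> : free_alg K I).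
  have -> : << c *g w >> = c *: (<< w >> : free_alg K I) :> free_alg K I.
    by apply/malgP => v; rewrite mcoeffZ !mcoeffU mulr_natr.
  rewrite !linearZ free_alg_monomE !rmorph_prod; congr (_ *: _).
  by apply: eq_bigr => i _; apply: fg.
by rewrite [x]monalgE !raddf_sum; apply: eq_bigr => w _; apply: fgU.
Qed.

Lemma free_alg_lift (I : choiceType) (A : algType K) (g : I -> A) :
  exists f : {lrmorphism free_alg K I -> A}, forall i, f (free_gen K i) = g i.
Proof.
pose h (w : fmonom I) : A := \prod_(i <- (w : seq I)) g i.
have hM : mmorphism h.
  by split=> [v w|]; rewrite /h ?fmM ?big_cat // fm1 big_nil.
pose hL : {mmorphism fmonom I -> A} := HB.pack h (isMultiplicative.Build _ _ h hM).
pose f (x : free_alg K I) : A := mmap (in_alg A) hL x.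
have fM : monoid_morphism f.
  have [fM f1] : multiplicative f; last by split.
  (* Multiplicativity into a noncommutative target needs the coefficients to commute with the images
     of words; scalars are central in [A]. *)
  apply: commr_mmap_is_multiplicative => x v w.
  by rewrite /GRing.comm mulr_algl mulr_algr.
have fB : zmod_morphism f by move=> x y; rewrite /f raddfB.
have fZ : scalable f by move=> a x; rewrite /f mmapZ /= mulr_algl.
pose fL : {lrmorphism free_alg K I -> A} := HB.pack f
  (GRing.isZmodMorphism.Build _ _ f fB)
  (GRing.isMonoidMorphism.Build _ _ f fM) (GRing.isScalable.Build _ _ _ _ f fZ).
exists fL => i; rewrite /= /f /free_gen mmapU /= scale1r mul1r /h.
by rewrite fmU big_seq1.
Qed.

End Presentations.

(** * Reindexing and collapsing finite sums *)

Lemma sum_mxtens (V : nmodType) (m n : nat) (F : 'I_(m * n) -> V) :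
  \sum_x F x = \sum_i \sum_j F (mxtens_index (i, j)).
Proof.
rewrite pair_big (reindex (@mxtens_index m n)) /=.
  by apply: eq_bigr => -[].
exists (@mxtens_unindex m n) => x _; first exact: mxtens_indexK.
exact: mxtens_unindexK.
Qed.

(** Serves to collapse the sums of matrix units in [RE_S], where the filters [i != j] and [i < k]
    survive as a test at [i0]. *)
Lemma sum_at (V : nmodType) (I : finType) (P : pred I) (i0 : I) (F : I -> V) :
  (forall i, i != i0 -> F i = 0) -> \sum_(i | P i) F i = if P i0 then F i0 else 0.
Proof.
move=> F0; rewrite big_mkcond (bigD1 i0) //= big1 ?addr0 // => i /F0 ->.
by rewrite if_same.
Qed.

(** * Entries of S *)

Section Entries.
Variables (K : fieldType) (q : K).

(** Row (a, b), column (c, d). The first two sums of S merge into a flip weighted by q on the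
    diagonal. Indices are natural numbers, so the S of size k is visibly a block of the S of size
    n. *)
Definition RE_S_entry (a b c d : nat) : K :=
  q ^+ (a == b) * ((a == d) && (b == c))%:R
  + (q - q^-1) * [&& (a < b)%N, a == c & b == d]%:R.

Lemma RE_SE (m : nat) (a b c d : 'I_m) :
  RE_S q m (mxtens_index (a, b)) (mxtens_index (c, d)) = RE_S_entry a b c d.
Proof.
have E i j i' j' : tensmx (delta_mx i i' : 'M[K]_m) (delta_mx j j' : 'M[K]_m)
    (mxtens_index (a, b)) (mxtens_index (c, d)) =
    [&& i == a, i' == c, j == b & j' == d]%:R.
  rewrite tensmxE !mxE -natrM mulnb.
  by rewrite (eq_sym i) (eq_sym i') (eq_sym j) (eq_sym j') -andbA.
have E0 i j i' j' : i != a \/ j != b -> tensmx (delta_mx i i' : 'M[K]_m)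
    (delta_mx j j' : 'M[K]_m) (mxtens_index (a, b)) (mxtens_index (c, d)) = 0.
  by rewrite E => -[] /negPf ->; rewrite ?andbF.
rewrite /RE_S /RE_S_entry !mxE !summxE (@sum_at _ _ _ a) => [|i ia]; last first.
  by apply: E0; left.
rewrite [X in _ + X + _](@sum_at _ _ _ a) => [|i ia]; last first.
  by rewrite summxE big1 // => j _; apply: E0; left.
rewrite summxE (@sum_at _ _ _ b) => [|i ib]; last by apply: E0; right.
rewrite [X in (q - _) * X](@sum_at _ _ _ a) => [|i ia]; last first.
  by rewrite summxE big1 // => j _; apply: E0; left.
rewrite summxE (@sum_at _ _ _ b) => [|i ib]; last by apply: E0; right.
rewrite !E !eqxx /= -!val_eqE /=; congr (_ + _); last by case: ltnP.
(* If a = b only the q-sum contributes to the flip, otherwise only the sum over i != j. *)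
case: (eqVneq (val a) b) => [->|ab] /=.
  by rewrite addr0 expr1; case: (_ =P val c); case: (_ =P val d).
by rewrite andbF mulr0 add0r mul1r andbC.
Qed.

End Entries.

(** * The reflection equation entry by entry *)

Section Corner.
Variables (K : fieldType) (q : K) (A : algType K).

(** An entry of L_2 S L_2. The identity in the first tensor factor leaves a and c fixed, so only
    second indices are summed. *)
Definition RE_core (m : nat) (L : 'M[A]_m) (a b c d : 'I_m) : A :=
  \sum_(x < m) \sum_(y < m) L b x * (RE_S_entry q a x c y)%:A * L y d.

Let SA (m : nat) : 'M[A]_(m * m) := map_mx (in_alg A) (RE_S q m).
Let L2 (m : nat) (L : 'M[A]_m) : 'M[A]_(m * m) := tensmx (1%:M : 'M[A]_m) L.

Lemma RE_coreE (m : nat) (L : 'M[A]_m) (a b c d : 'I_m) :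
  (L2 L *m SA m *m L2 L) (mxtens_index (a, b)) (mxtens_index (c, d)) =
  RE_core L a b c d.
Proof.
have L2S i j : (L2 L *m SA m) (mxtens_index (a, b)) (mxtens_index (i, j)) =
    \sum_(x < m) L b x * (RE_S_entry q a x i j)%:A.
  rewrite mxE sum_mxtens (bigD1 a) //= [X in _ + X]big1 => [|a' aa']; last first.
    by rewrite big1 // => x _; rewrite tensmxE mxE eq_sym (negPf aa') !mul0r.
  rewrite addr0; apply: eq_bigr => x _.
  by rewrite tensmxE mxE eqxx mul1r mxE RE_SE.
rewrite mxE sum_mxtens (bigD1 c) //= [X in _ + X]big1 => [|c' cc']; last first.
  by rewrite big1 // => x _; rewrite L2S tensmxE mxE (negPf cc') mul0r mulr0.
rewrite addr0 /RE_core exchange_big /=; apply: eq_bigr => y _.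
by rewrite L2S tensmxE mxE eqxx mul1r mulr_suml.
Qed.

Lemma RE_relationE (m : nat) (L : 'M[A]_m) (a b c d : 'I_m) :
  RE_relation q L (mxtens_index (a, b)) (mxtens_index (c, d)) =
  \sum_(e < m) \sum_(f < m) RE_core L a b e f * (RE_S_entry q e f c d)%:A
  - \sum_(e < m) \sum_(f < m) (RE_S_entry q a b e f)%:A * RE_core L e f c d.
Proof.
(* The relation says that L_2 S L_2 commutes with S. *)
have -> : RE_relation q L = (L2 L *m SA m *m L2 L) *m SA m
    - SA m *m (L2 L *m SA m *m L2 L) by rewrite !mulmxA.
rewrite mxE [X in _ + X]mxE; congr (_ - _); rewrite mxE sum_mxtens.
  by apply: eq_bigr => e _; apply: eq_bigr => f _; rewrite RE_coreE mxE RE_SE.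
by apply: eq_bigr => e _; apply: eq_bigr => f _; rewrite RE_coreE mxE RE_SE.
Qed.

End Corner.

(** * Reflection equation for a zero-padded matrix *)

Section Padding.
Variables (K : fieldType) (q : K) (A : algType K) (k n : nat) (hkn : (k <= n)%N).
Variable L : 'M[A]_n.
Hypothesis L0 : forall i j : 'I_n, (k <= i)%N || (k <= j)%N -> L i j = 0.

Local Notation w := (widen_ord hkn).
Let Lk : 'M[A]_k := mxsub w w L.

Lemma sum_widen (F : 'I_n -> A) :
  (forall i : 'I_n, (k <= i)%N -> F i = 0) -> \sum_i F i = \sum_(i < k) F (w i).
Proof.
move=> F0; rewrite -(big_ord_narrow hkn) [RHS]big_mkcond; apply: eq_bigr => i _.
by case: ltnP => // /F0.
Qed.

Lemma RE_core_widen (a b c d : 'I_k) :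
  RE_core q L (w a) (w b) (w c) (w d) = RE_core q Lk a b c d.
Proof.
rewrite /RE_core sum_widen => [|x kx]; last first.
  by rewrite big1 // => y _; rewrite L0 ?kx ?orbT // !mul0r.
apply: eq_bigr => x _; rewrite sum_widen => [|y ky]; last first.
  by rewrite (L0 (i := y)) ?ky // mulr0.
by apply: eq_bigr => y _; rewrite !mxE.
Qed.

Lemma RE_core_outer (a b c d : 'I_n) :
  [|| k <= a, k <= b, k <= c | k <= d]%N -> RE_core q L a b c d = 0.
Proof.
move=> out; rewrite /RE_core big1 // => x _; rewrite big1 // => y _.
have [bx|bx] := boolP ((k <= b) || (k <= x))%N; first by rewrite L0 // !mul0r.
have [yd|yd] := boolP ((k <= y) || (k <= d))%N; first by rewrite (L0 yd) mulr0.
(* Now x, y < k. The flip term forces a = y and c = x, the omega term a = c < x; either way a, c <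
   k, against [out]. *)
rewrite /RE_S_entry (_ : (_ == _) && _ = false) 1?(_ : [&& _, _ & _] = false);
  try lia.
by rewrite !mulr0 addr0 scale0r mulr0 mul0r.
Qed.

(** A nonzero entry has (c, d) equal to (b, a) or (a, b), so S never links a pair inside the block
    to one outside. *)
Lemma RE_S_entry_outer (a b c d : nat) :
  (a < k)%N && (b < k)%N != (c < k)%N && (d < k)%N -> RE_S_entry q a b c d = 0.
Proof.
move=> out.
rewrite /RE_S_entry (_ : (_ == _) && _ = false) 1?(_ : [&& _, _ & _] = false);
  try lia.
by rewrite !mulr0 addr0.
Qed.

Lemma RE_relation_padding : RE_relation q L = 0 <-> RE_relation q Lk = 0.
Proof.
(* The sums over e and f shrink to indices below k because [RE_core] vanishes at all others. *)
have inner (a b c d : 'I_k) :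
    RE_relation q L (mxtens_index (w a, w b)) (mxtens_index (w c, w d)) =
    RE_relation q Lk (mxtens_index (a, b)) (mxtens_index (c, d)).
  rewrite !RE_relationE; congr (_ - _).
    rewrite sum_widen => [|e ke]; last first.
      by rewrite big1 // => f _; rewrite RE_core_outer ?ke ?orbT ?mul0r.
    apply: eq_bigr => e _; rewrite sum_widen => [|f kf]; last first.
      by rewrite RE_core_outer ?kf ?orbT ?mul0r.
    by apply: eq_bigr => f _; rewrite RE_core_widen.
  rewrite sum_widen => [|e ke]; last first.
    by rewrite big1 // => f _; rewrite RE_core_outer ?ke ?orbT ?mulr0.
  apply: eq_bigr => e _; rewrite sum_widen => [|f kf]; last first.
    by rewrite RE_core_outer ?kf ?orbT ?mulr0.
  by apply: eq_bigr => f _; rewrite RE_core_widen.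
split=> [R0|R0]; apply/matrixP => x y.
  case: (mxtens_indexP x) => a b; case: (mxtens_indexP y) => c d.
  by rewrite -inner R0 !mxE.
case: (mxtens_indexP x) => a b; case: (mxtens_indexP y) => c d.
have [/and4P[ak bk ck dk]|out] := boolP [&& a < k, b < k, c < k & d < k]%N.
  have wE (i : 'I_n) (ik : (i < k)%N) : i = w (Ordinal ik) by apply: val_inj.
  by rewrite (wE a ak) (wE b bk) (wE c ck) (wE d dk) inner R0 !mxE.
(* Each summand vanishes: either [RE_core] has an index outside the block, or its four indices lie
   inside and then, by [out], the S factor joins an inner pair to an outer one. *)
rewrite [RHS]mxE RE_relationE !big1 ?subrr // => e _; rewrite big1 // => f _.
  have [efcd|efcd] := boolP [&& e < k, f < k, c < k & d < k]%N.
    by rewrite RE_S_entry_outer ?scale0r ?mul0r //; lia.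
  by rewrite RE_core_outer ?mulr0 //; lia.
have [abef|abef] := boolP [&& a < k, b < k, e < k & f < k]%N.
  by rewrite RE_S_entry_outer ?scale0r ?mulr0 //; lia.
by rewrite RE_core_outer ?mul0r //; lia.
Qed.

End Padding.

(** * Universal property of the reflection equation algebra *)

Section UniversalProperty.
Variables (K : fieldType) (q : K) (m : nat).

(** The entries of S are scalars, which algebra morphisms preserve. *)
Lemma RE_relation_map (A B : algType K) (f : {lrmorphism A -> B}) (L : 'M[A]_m) :
  map_mx f (RE_relation q L) = RE_relation q (map_mx f L).
Proof.
have fS : map_mx f (map_mx (in_alg A) (RE_S q m)) = map_mx (in_alg B) (RE_S q m).
  by apply/matrixP => i j; rewrite !mxE /= linearZ rmorph1.
have fL2 : map_mx f (tensmx (1%:M : 'M_m) L) = tensmx (1%:M : 'M_m) (map_mx f L).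
  by apply/matrixP => i j; rewrite !mxE rmorphM rmorph_nat.
by rewrite /RE_relation map_mxB !map_mxM fS fL2.
Qed.

Lemma RE_freeLE (i j : 'I_m) : RE_freeL K m i j = free_gen K (j, i).
Proof.
rewrite /RE_freeL summxE (sum_at _ (i0 := j)) => [|j' jj']; last first.
  by rewrite summxE big1 // => i' _; rewrite !mxE (eq_sym j) (negPf jj') andbF mulr0.
rewrite summxE (sum_at _ (i0 := i)) => [|i' ii']; last first.
  by rewrite !mxE (eq_sym i) (negPf ii') mulr0.
by rewrite !mxE !eqxx mulr1.
Qed.

(** The universal solution of the reflection equation. *)
Definition RE_genL : 'M[RE_alg q m]_m := \matrix_(i, j) RE_gen q j i.

Lemma RE_genL_relation : RE_relation q RE_genL = 0.
Proof.
have -> : RE_genL = map_mx (quot_pi (RE_relations_proper q m)) (RE_freeL K m).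
  by apply/matrixP => i j; rewrite !mxE RE_freeLE.
rewrite -RE_relation_map; apply/matrixP => i j; rewrite mxE [RHS]mxE.
by apply: quot_pi_gen; exists i, j.
Qed.

(** Evaluating the free algebra at the entries of [L] kills the relations, by naturality of
    [RE_relation]. *)
Lemma RE_alg_lift (A : algType K) (L : 'M[A]_m) :
  RE_relation q L = 0 ->
  exists f : {lrmorphism RE_alg q m -> A}, forall i j, f (RE_gen q i j) = L j i.
Proof.
move=> L0; have [f fE] := free_alg_lift (fun ij => L ij.2 ij.1).
have [x [a [b ->]]|g gE] := quot_alg_lift (RE_relations_proper q m) (f := f).
  have fL : map_mx f (RE_freeL K m) = L.
    by apply/matrixP => i j; rewrite mxE RE_freeLE fE.
  by have := congr1 (fun M : 'M_(m * m) => M a b) (RE_relation_map f (RE_freeL K m));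
     rewrite fL L0 mxE => ->; rewrite mxE.
by exists g => i j; rewrite gE fE.
Qed.

Lemma RE_alg_ext (A : algType K) (f g : {lrmorphism RE_alg q m -> A}) :
  (forall i j, f (RE_gen q i j) = g (RE_gen q i j)) -> f =1 g.
Proof.
move=> fg; elim/quot_ind => x.
pose p : {lrmorphism free_alg K _ -> RE_alg q m} := quot_pi (RE_relations_proper q m).
by apply: (@free_alg_ext _ _ _ (f \o p) (g \o p)) => -[i j]; apply: fg.
Qed.

End UniversalProperty.

(** * The two inverse morphisms *)

Lemma RE_alg_corner (K : fieldType) (q : K) (k n : nat) :
  (k <= n)%N ->
  alg_isomorphic (quot_alg (RE_outer_gens q n k) (RE_outer_gens_proper q n k))
    (RE_alg q k).
Proof.
move=> hkn; pose w := widen_ord hkn.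
set Q := quot_alg _ _.
pose p : {lrmorphism RE_alg q n -> Q} := quot_pi (RE_outer_gens_proper q n k).
have p0 (i j : 'I_n) : (k <= i)%N || (k <= j)%N -> p (RE_gen q i j) = 0.
  by move=> /orP out; apply: quot_pi_gen; exists i, j.
(* [insub] succeeds exactly on indices below k; the default 0 is the padding. *)
pose Lpad : 'M[RE_alg q k]_n :=
  \matrix_(i, j) if insub (val i) is Some i' then
    if insub (val j) is Some j' then RE_genL q k i' j' else 0 else 0.
have Lpad0 (i j : 'I_n) : (k <= i)%N || (k <= j)%N -> Lpad i j = 0.
  rewrite mxE; case: insubP => // i' ik _; case: insubP => // j' jk _.
  by rewrite leqNgt ik leqNgt jk.
have LpadE (i j : 'I_k) : Lpad (w i) (w j) = RE_gen q j i.
  by rewrite mxE /= !valK mxE.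
have Lpadw : mxsub w w Lpad = RE_genL q k.
  by apply/matrixP => i j; rewrite [LHS]mxE LpadE mxE.
have [|f fE] := @RE_alg_lift _ q n _ Lpad.
  by apply/(RE_relation_padding q hkn Lpad0); rewrite Lpadw RE_genL_relation.
have [x [i [j [out ->]]]|F FE] := quot_alg_lift (RE_outer_gens_proper q n k) (f := f).
  by rewrite fE Lpad0 // orbC; apply/orP.
(* In [Q] the outer generators vanish, so the image of [RE_genL] is itself padded, and its corner
   satisfies the equation of size k. *)
have [|g gE] := @RE_alg_lift _ q k _ (mxsub w w (map_mx p (RE_genL q n))).
  apply/(RE_relation_padding q hkn) => [i j out|].
    by rewrite !mxE p0 // orbC.
  by rewrite -RE_relation_map RE_genL_relation map_mx0.
exists F, g => [|y]; last first.
  apply: (@RE_alg_ext _ _ _ _ (F \o g) idfun) => i j /=.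
  by rewrite gE !mxE FE fE LpadE.
elim/quot_ind => x.
(* Precomposing with the surjection [p] reduces the identity on [Q] to generators of the algebra of
   size n. *)
apply: (@RE_alg_ext _ _ _ _ (g \o F \o p) p) => i j /=.
rewrite FE fE; have [out|] := boolP ((k <= j) || (k <= i))%N.
  by rewrite Lpad0 // raddf0 p0 // orbC.
rewrite negb_or -!ltnNge => /andP[jk ik].
have wE (a : 'I_n) (ak : (a < k)%N) : a = w (Ordinal ak) by apply: val_inj.
by rewrite (wE _ ik) (wE _ jk) LpadE gE !mxE.
Qed.

Theorem proposition11p4 (R : realType) (k n : nat)
    (hk : (0 < k)%N) (hkn : (k < n)%N) :
  alg_isomorphic
    (quot_alg (RE_outer_gens (qvar R) n k) (RE_outer_gens_proper (qvar R) n k))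
    (RE_alg (qvar R) k).
Proof. exact/RE_alg_corner/ltnW. Qed.
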